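(* Let $p$ be a prime, let $n$ be a positive integer, let $\mathbf{x}$ be uniformly distributed on $\mathbb{F}_p^n$, and let $C\in\mathbb{F}_p^{n\times n}$ be a diagonal matrix of rank $r$. Then for all $a\in\mathbb{F}_p$, $$\left|\Pr\left(\mathbf{x}^TC\mathbf{x}=a\right)-\frac1p\right|\le p^{-r/2}.$$
   Context: $\mathbb{F}_p$ is the field with $p$ elements. The probability is over the uniform choice of $\mathbf{x}\in\mathbb{F}_p^n$. *)

(* Defs.v *)
From mathcomp Require Import all_boot all_order all_algebra.
From mathcomp Require Import reals.

Set Implicit Arguments.
Unset Strict Implicit.
Unset Printing Implicit Defensive.

Import GRing.Theory Num.Theory.
Local Open Scope ring_scope.

(* Probability of the event P for the uniform distribution on T. When T is
   empty the division by zero makes it 0. *)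
Definition uniform_pr (R : realType) (T : finType) (P : pred T) : R :=
  #|[set x : T | P x]|%:R / #|T|%:R.

Definition quad_form (F : fieldType) (n : nat) (C : 'M[F]_n) (x : 'cV[F]_n)
  : F := (x^T *m C *m x) 0 0.

(* Main.v *)
(** Fourier analysis with a nontrivial additive character [e] of [F_p] writes
    [p * N - p ^ n], where [N] counts the solutions, as the sum over [t != 0] of
    [e (- t a)] times a product of one-variable sums [\sum_y e (t c_i y ^ 2)].
    Such a sum is [p] if [c_i = 0], and otherwise a Gauss sum, of modulus at
    most [sqrt p]; at least [r] of the [c_i] are nonzero. The estimate takes
    place in [algC] and reaches the abstract reals as an inequality between
    integers, by squaring it. *)

Require Import Defs.
From mathcomp Require Import all_boot all_order all_algebra all_field.
From mathcomp Require Import reals exp ring.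

Import Order.TTheory GRing.Theory Num.Theory.
Local Open Scope ring_scope.

(** Each nonzero diagonal entry contributes a matrix of rank at most one, and rank is subadditive.
    This direction suffices, since further nonzero entries only sharpen the final estimate. *)
Lemma diag_mx_rank_le (F : fieldType) (n : nat) (C : 'M[F]_n) :
  is_diag_mx C -> (\rank C <= #|[pred i | C i i != 0%R]|)%N.
Proof.
move=> /is_diag_mxP Cdiag.
have defC : C = \sum_(i | C i i != 0) C i i *: delta_mx i i.
  apply/matrixP => j k; rewrite summxE.
  have [<-|neq_jk] := eqVneq j k; last first.
    rewrite Cdiag // big1 // => i _; rewrite !mxE.
    by have [<-|] := eqVneq j i; rewrite ?(eq_sym k) ?(negPf neq_jk) mulr0.
  under eq_bigr => i _ do rewrite !mxE andbb -[_%:R]/((j == i)%:R : F).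
  have [Cj0|Cjn0] := eqVneq (C j j) 0.
    rewrite big1 // => i Cin0; have [eq_ji|_] := eqVneq j i; rewrite ?mulr0 //.
    by rewrite -eq_ji Cj0 eqxx in Cin0.
  rewrite (bigD1 j) //= eqxx mulr1 big1 ?addr0 // => i /andP[_ neq_ij].
  by rewrite eq_sym (negPf neq_ij) mulr0.
rewrite {1}defC -sum1_card.
elim/big_ind2: _ => [|m1 B1 m2 B2 le1 le2|i _]; first by rewrite mxrank0.
  exact: leq_trans (mxrank_add _ _) (leq_add le1 le2).
by apply: leq_trans (mxrank_scale _ _) _; rewrite mxrank_delta.
Qed.

Lemma quad_form_diag (F : fieldType) (n : nat) (C : 'M[F]_n) (x : 'cV[F]_n) :
  is_diag_mx C -> quad_form C x = \sum_i C i i * x i 0 ^+ 2.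
Proof.
move=> /is_diag_mxP Cdiag; rewrite /quad_form -mulmxA mxE.
apply: eq_bigr => i _; rewrite !mxE (bigD1 i) //= big1 ?addr0 => [|j neq_ji].
  by rewrite mulrCA expr2.
by rewrite Cdiag ?mul0r // eq_sym.
Qed.

Lemma sum_cV_prod (S : comNzRingType) (T : finType) (n : nat)
    (f : 'I_n -> T -> S) :
  \sum_(x : 'cV[T]_n) \prod_i f i (x i 0) = \prod_i \sum_y f i y.
Proof.
rewrite bigA_distr_bigA (reindex (fun g : {ffun 'I_n -> T} => \col_i g i)) /=.
  by apply: eq_bigr => g _; apply: eq_bigr => i _; rewrite mxE.
exists (fun x : 'cV[T]_n => [ffun i => x i 0]) => [g _|x _].
  by apply/ffunP => i; rewrite ffunE mxE.
by apply/colP => i; rewrite mxE ffunE.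
Qed.

Lemma Fp_char_exists (p : nat) : prime p -> exists e : 'F_p -> algC,
  [/\ {morph e : x y / x + y >-> x * y}, forall x, `|e x| = 1 & e 1 != 1].
Proof.
move=> p_pr; have [z zP] := C_prim_root_exists (prime_gt0 p_pr).
(* The exponent is the natural number representing [x]; [z] has order [p], so reducing sums modulo
   [p] is harmless. *)
exists (fun x => z ^+ x); split=> [x y|x|].
- rewrite -exprD -(prim_expr_mod zP (x + y)); congr (_ ^+ _) => /=.
  by congr (_ %% _)%N; apply: Fp_cast.
- rewrite normrX (_ : `|z| = 1) ?expr1n //.
  apply/eqP; rewrite -(@pexpr_eq1 _ _ p) ?prime_gt0 //.
  by rewrite -normrX (prim_expr_order zP) normr1.
by rewrite -(prim_order_dvd zP) /= Fp_cast // modn_small ?prime_gt1 // dvdn1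
   neq_ltn prime_gt1 // orbT.
Qed.

Section AdditiveCharacter.

Context (F : finFieldType) (e : F -> algC).
Hypothesis eD : {morph e : x y / x + y >-> x * y}.
Hypothesis norm_e : forall x, `|e x| = 1.
Hypothesis e_neq1 : e 1 != 1.

Local Notation q := (#|F|%:R : algC).

Lemma char_neq0 x : e x != 0.
Proof. by rewrite -normr_eq0 norm_e oner_eq0. Qed.

Lemma char0 : e 0 = 1.
Proof. by apply: (mulfI (char_neq0 0)); rewrite -eD addr0 mulr1. Qed.

Lemma charN x : e (- x) = (e x)^*.
Proof.
by apply: (mulfI (char_neq0 x)); rewrite -eD subrr char0 -normCK norm_e expr1n.
Qed.

Lemma char_sum (I : finType) (f : I -> F) :
  e (\sum_i f i) = \prod_i e (f i).
Proof. exact: (big_morph e eD char0). Qed.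

Lemma sum_char t : \sum_x e (t * x) = (t == 0)%:R * q.
Proof.
have [->|t_neq0] := eqVneq t 0.
  under eq_bigr => x _ do rewrite mul0r char0.
  by rewrite sumr_const mul1r.
(* Translating [x] by [t^-1] multiplies the sum by [e 1]; a nonzero sum would force [e 1 = 1]. *)
rewrite mul0r; apply/eqP; move: e_neq1; apply: contraNT => S_neq0.
apply/eqP/(mulIf S_neq0); rewrite mul1r mulr_sumr.
rewrite [RHS](reindex_inj (addrI t^-1)) /=.
by apply: eq_bigr => x _; rewrite mulrDr mulfV // eD.
Qed.

Lemma pchar2_sqr_inj : 2%:R = 0 :> F -> injective (fun x : F => x ^+ 2).
Proof.
move=> two0 x y /= /eqP; rewrite eqf_sqr => /orP[/eqP//|/eqP ->].
by apply/eqP; rewrite eq_sym -subr_eq0 opprK -mulr2n -mulr_natl two0 mul0r.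
Qed.

(* Substituting [x = y + h] makes the square of the modulus
   [\sum_h e (t * h ^+ 2) * \sum_y e (2 * t * h * y)]. *)
Lemma gauss_sum_sqr_le t : t != 0 -> `|\sum_x e (t * x ^+ 2)| ^+ 2 <= q.
Proof.
move=> t_neq0.
have -> : `|\sum_x e (t * x ^+ 2)| ^+ 2 =
    \sum_h e (t * h ^+ 2) * ((2%:R * t * h == 0)%:R * q).
  rewrite normCK rmorph_sum mulr_sumr.
  under [RHS]eq_bigr => h _ do rewrite -sum_char mulr_sumr.
  rewrite [RHS]exchange_big /=; apply: eq_bigr => y _.
  rewrite mulr_suml (reindex_inj (addrI y)) /=; apply: eq_bigr => h _.
  by rewrite -charN -!eD; congr e; ring.
(* If 2 is invertible, only [h = 0] survives and contributes exactly [q]. *)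
have [two0|two_neq0] := eqVneq (2%:R : F) 0; last first.
  rewrite (bigD1 0) //= big1 => [|h h_neq0].
    by rewrite expr0n !mulr0 char0 eqxx !mul1r addr0.
  by rewrite !mulf_eq0 (negPf two_neq0) (negPf t_neq0) (negPf h_neq0) mul0r mulr0.
(* In characteristic 2 every [h] survives, but squaring permutes [F], so what remains is a
   nontrivial character sum, hence 0. *)
under eq_bigr => h _ do rewrite two0 !mul0r eqxx mul1r.
rewrite -mulr_suml.
rewrite (_ : \sum_h _ = \sum_h e (t * h)).
  by rewrite sum_char (negPf t_neq0) !mul0r ler0n.
by rewrite [RHS](reindex_inj (pchar2_sqr_inj two0)).
Qed.

(* By orthogonality of characters, [q] times the indicator of
   [quad_form C x == a] is a sum over [t]; the term [t = 0] is the main term. *)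
Lemma count_quad_formE n (C : 'M[F]_n) a : is_diag_mx C ->
  q * #|[set x : 'cV[F]_n | quad_form C x == a]|%:R - q ^+ n =
  \sum_(t | t != 0) e (- (t * a)) * \prod_i \sum_y e (t * C i i * y ^+ 2).
Proof.
move=> Cdiag; have -> : q ^+ n =
    e (- (0 * a)) * \prod_i \sum_y e (0 * C i i * y ^+ 2).
  rewrite mul0r oppr0 char0 mul1r -[n in LHS]card_ord -prodr_const.
  apply: eq_bigr => i _; rewrite -sumr_const; apply: eq_bigr => y _.
  by rewrite !mul0r char0.
suff -> : q * #|[set x : 'cV[F]_n | quad_form C x == a]|%:R =
    \sum_t e (- (t * a)) * \prod_i \sum_y e (t * C i i * y ^+ 2).
  by rewrite (bigD1 0) //= addrAC subrr add0r.
under eq_bigr => t _ do rewrite -sum_cV_prod mulr_sumr.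
rewrite exchange_big /= -[X in _ * X%:R]sum1_card.
rewrite [X in _ * X]natr_sum mulr_sumr big_mkcond /=.
apply: eq_bigr => x _; rewrite inE.
transitivity (\sum_t e ((quad_form C x - a) * t)).
  by rewrite sum_char subr_eq0; case: eqP; rewrite ?mulr1 ?mul1r ?mul0r.
apply: eq_bigr => t _; rewrite mulrBl eD mulrC [a * t]mulrC; congr (_ * _).
rewrite -char_sum; congr e; rewrite quad_form_diag // mulr_suml.
by apply: eq_bigr => i _; rewrite mulrC mulrA.
Qed.

(** Each coordinate has a budget of [q * q]: a zero [c i] uses it all through its squared sum, while
    a nonzero one pairs a squared Gauss sum, at most [q], with one factor of [q ^+ #|...|]. *)
Lemma prod_gauss_sum_sqr_le n (c : 'I_n -> F) t : t != 0 ->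
  `|\prod_i \sum_y e (t * c i * y ^+ 2)| ^+ 2 * q ^+ #|[pred i | c i != 0%R]|
    <= q ^+ (n + n).
Proof.
move=> t_neq0; rewrite normr_prod -prodrXl -[X in _ * X]prodr_const.
rewrite [X in _ * X]big_mkcond -big_split /=.
rewrite -[n in leRHS]card_ord exprD -prodr_const -big_split /=.
apply: ler_prod => i _; rewrite inE; case: eqP => [->|/eqP ci_neq0] /=.
  rewrite mulr1 exprn_ge0 //=.
  under eq_bigr => y _ do rewrite mulr0 mul0r char0.
  by rewrite sumr_const normr_nat expr2.
rewrite mulr_ge0 ?exprn_ge0 ?ler0n //= ler_wpM2r ?ler0n //.
by rewrite gauss_sum_sqr_le ?mulf_neq0.
Qed.

Lemma count_quad_form_le n (C : 'M[F]_n) a : is_diag_mx C ->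
  `|q * #|[set x : 'cV[F]_n | quad_form C x == a]|%:R - q ^+ n| ^+ 2
    * q ^+ #|[pred i | C i i != 0%R]| <= (q ^+ n.+1) ^+ 2.
Proof.
move=> Cdiag; rewrite count_quad_formE //; set k := #|[pred i | C i i != 0]|.
rewrite -[q in q ^+ k]sqrtCK [_ ^+ 2 ^+ k]exprAC -exprMn.
have s_ge0 : 0 <= sqrtC q ^+ k by rewrite exprn_ge0 ?sqrtC_ge0 ?ler0n.
rewrite lerXn2r ?nnegrE ?mulr_ge0 ?exprn_ge0 ?sqrtC_ge0 ?ler0n //.
apply: le_trans (ler_wpM2r s_ge0 (ler_norm_sum _ _ _)) _.
rewrite mulr_suml exprS mulr_natl -[leRHS]sumr_const.
(* The triangle inequality leaves only [q - 1] terms; a spare [q ^+ n] at [t = 0] rounds this up to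
   [q]. *)
rewrite [leRHS](bigD1 0) //= ler_wpDl ?exprn_ge0 ?ler0n //.
rewrite ler_sum // => t t_neq0.
rewrite normrM norm_e mul1r.
rewrite -(@ler_pXn2r _ 2) ?nnegrE ?mulr_ge0 ?exprn_ge0 ?sqrtC_ge0 ?ler0n //.
rewrite exprMn exprAC sqrtCK -exprM muln2 -addnn.
exact: prod_gauss_sum_sqr_le.
Qed.

Lemma uniform_pr_quad_form_le (R : realType) n (C : 'M[F]_n) a : is_diag_mx C ->
  `|uniform_pr R (fun x : 'cV[F]_n => quad_form C x == a) - #|F|%:R^-1| ^+ 2
    * #|F|%:R ^+ #|[pred i | C i i != 0%R]| <= 1.
Proof.
move=> Cdiag; have := count_quad_form_le n C a Cdiag; rewrite /uniform_pr.
set N := #|[set x | _]|; set k := #|[pred i | C i i != 0]|.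
have q_gt0 : 0 < (#|F|%:R : R) by rewrite ltr0n; apply/card_gt0P; exists 0.
have q_neq0 := lt0r_neq0 q_gt0.
rewrite card_mx muln1 natrX.
have -> : N%:R / #|F|%:R ^+ n - #|F|%:R^-1 =
    (#|F|%:R * N%:R - #|F|%:R ^+ n) / #|F|%:R ^+ n.+1 :> R.
  rewrite exprS mulrBl -mulf_div divff // mul1r invfM mulrCA.
  by rewrite divff ?expf_neq0 // mulr1.
move=> count_le; rewrite normf_div [`|_ ^+ n.+1|]ger0_norm ?exprn_ge0 ?ler0n //.
rewrite expr_div_n [leLHS]mulrAC.
rewrite ler_pdivrMr ?exprn_gt0 // mul1r.
(* Squaring removed the half-integral powers of [q], so both sides are images of integers and the
   order can be compared in [int]. *)
pose D : int := (#|F| * N)%:Z - (#|F| ^ n)%:Z.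
have E (K : numDomainType) : #|F|%:R * N%:R - #|F|%:R ^+ n = D%:~R :> K.
  by rewrite rmorphB /= -!pmulrn natrM natrX.
have P (K : numDomainType) m : (#|F|%:R : K) ^+ m = (#|F| ^ m)%:Z%:~R.
  by rewrite -pmulrn natrX.
by move: count_le; rewrite !E !P -!intr_norm -!rmorphXn -!rmorphM /= !ler_int.
Qed.

End AdditiveCharacter.

Theorem claim2 (R : realType) (p n r : nat) (hp : prime p) (hn : (0 < n)%N)
    (C : 'M['F_p]_n) (hdiag : is_diag_mx C) (hrank : \rank C = r)
    (a : 'F_p) :
  `| uniform_pr R (fun x : 'cV['F_p]_n => quad_form C x == a) - p%:R^-1 |
    <= (p%:R : R) `^ (- (r%:R / 2)).
Proof.
have [e [eD norm_e e_neq1]] := Fp_char_exists p hp.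
have := uniform_pr_quad_form_le _ e eD norm_e e_neq1 R n C a hdiag.
rewrite card_Fp //; set k := #|[pred i | _]| => dev_le.
have p_ge1 : 1 <= (p%:R : R) by rewrite ler1n prime_gt0.
have p_gt0 : 0 < (p%:R : R) := lt_le_trans ltr01 p_ge1.
have r_le_k : (r <= k)%N by rewrite -hrank diag_mx_rank_le.
rewrite -(@ler_pXn2r _ 2) ?nnegrE ?normr_ge0 ?powR_ge0 //.
have -> : (p%:R `^ (- (r%:R / 2)) : R) ^+ 2 = (p%:R ^+ r)^-1.
  by rewrite -powR_mulrn ?powR_ge0 // -powRrM mulNr divfK ?pnatr_eq0 //
    powRN powR_mulrn ?ltW.
(* Lowering the exponent from [k] to [r] weakens the bound because [1 <= p]. *)
rewrite -[leRHS]mul1r ler_pdivlMr ?exprn_gt0 //; apply: le_trans dev_le.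
by rewrite ler_wpM2l ?exprn_ge0 ?normr_ge0 // ler_weXn2l.
Qed.
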